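(* Let $T=(V,E)$ be a tree rooted at $v_1$ with leaf set $Y$, let $w\le u$ be real edge vectors, $c>0$ an edge cost vector, and $M\in\mathbb{R}$. Define $\hat w(e)=u(e)$ if $c(e)\le M$ and $\hat w(e)=w(e)$ if $c(e)>M$. Then $\hat w$ is an optimal solution of the problem (MSPIT$_{BH}$).
   Context: For each leaf $t_k$, $P_k$ is the edge set of the path from $v_1$ to $t_k$; for $f:E\to\mathbb{R}$, $f(P_k):=\sum_{e\in P_k}f(e)$. $H(a,b)=1$ if $a\neq b$ and $0$ otherwise. The problem (MSPIT$_{BH}$) is: maximize $D(\hat w):=\min_{t_k\in Y}\hat w(P_k)$ over $\hat w:E\to\mathbb{R}$ subject to $\max_{e\in E}c(e)H(\hat w(e),w(e))\le M$ and $w(e)\le\hat w(e)\le u(e)$ for all $e\in E$.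
   Formalization: The formal statement assumes M ≥ 0; for M < 0 and E nonempty, every value c(e)H(·,·) is ≥ 0 > M, so the problem has no feasible solution and the claim fails as literally stated. *)

(* Defs.v *)
From mathcomp Require Import all_boot all_order all_algebra.
From mathcomp Require Import boolp classical_sets reals constructive_ereal.

Set Implicit Arguments.
Unset Strict Implicit.
Unset Printing Implicit Defensive.
Import Order.TTheory GRing.Theory Num.Theory.
Local Open Scope ring_scope.

(* A finite simple graph (V, E): E is a set of two-element subsets of V. *)
Definition simple_graph (V : finType) (E : {set {set V}}) : Prop :=
  forall e : {set V}, e \in E -> #|e| = 2%N.

Definition edge (V : finType) (E : {set {set V}}) : finType :=
  {e : {set V} | e \in E}.

Definition adj (V : finType) (E : {set {set V}}) : rel V :=
  fun x y => [set x; y]%SET \in E.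

Definition connected (V : finType) (E : {set {set V}}) : Prop :=
  forall x y : V, connect (adj E) x y.

Definition acyclic (V : finType) (E : {set {set V}}) : Prop :=
  forall s : seq V, (2 < size s)%N -> ~ ucycle (adj E) s.

(* Nonemptiness of V comes from the root, which is always given. *)
Definition is_tree (V : finType) (E : {set {set V}}) : Prop :=
  [/\ simple_graph E, connected E & acyclic E].

(* The vertices visited are x :: p, all distinct, ending at y. *)
Definition simple_path (V : finType) (E : {set {set V}}) (x y : V)
    (p : seq V) : bool :=
  [&& path (adj E) x p, last x p == y & uniq (x :: p)].

(* In a tree there is exactly one simple path from x to y, see tree_pathP and
   simple_path_uniq below. *)
Definition tree_path (V : finType) (E : {set {set V}}) (x y : V) : seq V :=
  xget [::] [set p | simple_path E x y p]%classic.

(* The edge set of the path from r to t. *)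
Definition path_edges (V : finType) (E : {set {set V}}) (r t : V) :
    {set edge E} :=
  [set e : edge E |
     val e \in pairmap (fun x y => [set x; y]%SET) r (tree_path E r t)]%SET.

(* y is a child of x in the tree rooted at r. *)
Definition child (V : finType) (E : {set {set V}}) (r x y : V) : bool :=
  adj E x y && (x \in r :: tree_path E r y).

(* Leaves of the rooted tree are the vertices without children; so a root of
   degree one is not a leaf, unlike the only vertex of a one-vertex tree. *)
Definition leaves (V : finType) (E : {set {set V}}) (r : V) : {set V} :=
  [set t | [forall y, ~~ child E r t y]]%SET.

Section Problem.
Variables (R : realType) (V : finType) (E : {set {set V}}) (r : V).
Implicit Types (w u c x : edge E -> R) (M : R).

Definition path_length x (t : V) : R := \sum_(e in path_edges E r t) x e.

Definition hamming (a b : R) : R := (a != b)%:R.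

(* The minimum of the path lengths over the leaves; there is at least one leaf
   (leaves_neq0), so the unit +oo of the minimum is never its value. *)
Definition objective x : \bar R :=
  \big[Order.min/+oo%E]_(t in leaves E r) (path_length x t)%:E.

(* All the c e * hamming _ _ are nonnegative, so that starting the maximum at 0
   only fixes its value when there is no edge. *)
Definition feasible w u c M x : Prop :=
  \big[Order.max/0]_(e : edge E) (c e * hamming (x e) (w e)) <= M
  /\ (forall e, w e <= x e <= u e).

Definition optimal_solution w u c M x : Prop :=
  feasible w u c M x
  /\ (forall y, feasible w u c M y -> (objective y <= objective x)%E).

End Problem.

Section TreeFacts.
Variables (V : finType) (E : {set {set V}}).
Hypothesis tE : is_tree E.

Lemma adjC x y : adj E x y = adj E y x.
Proof. by rewrite /adj finset.setUC. Qed.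

Lemma tree_pathP x y : simple_path E x y (tree_path E x y).
Proof.
case: tE => _ /(_ x y)/connectP[p pp ->] _.
case: (shortenP pp) => q pq uq _.
by apply: (@xgetPex _ [::] [set p | simple_path E x (last x q) p]%classic);
  exists q; rewrite /= /simple_path pq uq eqxx.
Qed.

Lemma simple_path_uniq x y p q :
  simple_path E x y p -> simple_path E x y q -> p = q.
Proof.
elim: p x q => [|a p IH] x [|b q] //.
- move=> /and3P[_ /= /eqP xy _] /and3P[_ /= /eqP ly /andP[+ _]].
  by rewrite xy -{1}ly mem_last.
- move=> /and3P[_ /= /eqP ly /andP[+ _]] /and3P[_ /= /eqP xy _].
  by rewrite xy -{1}ly mem_last.
move=> /and3P[/= /andP[xa pp] /eqP lp /andP[xp up]].
move=> /and3P[/= /andP[xb pq] /eqP lq /andP[xq uq]].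
case: (eqVneq a b) => [ab|neq_ab].
  subst b; congr (_ :: _); apply: (IH a).
    by rewrite /simple_path /= pp lp eqxx.
  by rewrite /simple_path /= pq lq eqxx.
have pr : path (adj E) a (p ++ rev (belast b q)).
  rewrite cat_path pp lp -lq rev_path.
  by rewrite (eq_path (e' := adj E)) // => z t; rewrite adjC.
have lr : last a (p ++ rev (belast b q)) = b.
  rewrite last_cat; case: (q) lq => [|d s] /=; first by rewrite lp => ->.
  by rewrite rev_cons last_rcons.
have xr : x \notin a :: p ++ rev (belast b q).
  apply: contra xp; rewrite !inE mem_cat mem_rev => /orP[->//|/orP[->|/mem_belast]].
    by rewrite orbT.
  by move=> xbq; rewrite xbq in xq.
case: (shortenP pr) lr => s ps us sub lr.
case: tE => _ _ /(_ [:: x, a & s]) [].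
  by case: s lr {ps us sub} => //= ab; rewrite ab eqxx in neq_ab.
apply/andP; split; last first.
  rewrite cons_uniq us andbT; apply: contra xr; rewrite !inE.
  by case/orP => [->//|/sub ->]; rewrite orbT.
by rewrite /= xa rcons_path ps lr adjC xb.
Qed.

Lemma leaves_neq0 r : leaves E r != finset.set0.
Proof.
have [t _ max_t] := @arg_maxnP _ r xpredT (fun t => size (tree_path E r t)) isT.
apply/set0Pn; exists t; rewrite inE; apply/forallP => y; apply/negP.
move=> /andP[ty tP]; have := max_t y isT; apply/negP; rewrite -ltnNge.
have neq_ty : t != y.
  apply/eqP => e; case: tE => /(_ [set t; y]%SET ty) + _ _.
  by rewrite e finset.setUid cards1.
have := tree_pathP r y; case/splitPl: tP => p1 p2 lp1.
move=> /and3P[]; rewrite cat_path => /andP[pp1 _] + up.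
rewrite last_cat lp1 => /eqP lp2.
have -> : tree_path E r t = p1.
  apply: simple_path_uniq (tree_pathP r t) _.
  rewrite /simple_path pp1 lp1 eqxx /=.
  by move: up; rewrite -cat_cons cat_uniq => /andP[].
rewrite size_cat -[X in (X < _)%N]addn0 ltn_add2l.
by case: p2 lp2 {up} => //= e; rewrite e eqxx in neq_ty.
Qed.

End TreeFacts.

(* Without 0 <= M there is no feasible, hence no optimal, solution. *)
Lemma feasible_ex (R : realType) (V : finType) (E : {set {set V}})
    (w u c : edge E -> R) (M : R) :
  (forall e, w e <= u e) ->
  (exists x, feasible w u c M x) <-> 0 <= M.
Proof.
move=> wu; split => [[x [xM _]]|M0].
  apply: le_trans xM; elim/big_rec: _ => // e z _ z0.
  by rewrite le_max z0 orbT.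
exists w; split => [|e]; last by rewrite lexx wu.
rewrite (_ : \big[_/_]_e _ = 0) //; elim/big_rec: _ => // e z _ ->.
by rewrite /hamming eqxx mulr0 maxxx.
Qed.

(* Main.v *)
Require Import Defs.
From mathcomp Require Import all_boot all_order all_algebra.
From mathcomp Require Import reals constructive_ereal.
Import Order.TTheory GRing.Theory Num.Theory.
Local Open Scope ring_scope.

Set Implicit Arguments.
Unset Strict Implicit.
Unset Printing Implicit Defensive.

(** The candidate is the greatest feasible vector edge by edge. Where [c e <= M] it reaches the cap
    [u e]; where [M < c e], feasibility forces the value [w e] ([feasible_costly]). The objective is
    a minimum of sums of edge values, hence monotone ([objective_le]), so dominating every feasible
    vector edgewise gives optimality. *)

Lemma objective_le (R : realType) (V : finType) (E : {set {set V}}) (r : V)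
    (x y : edge E -> R) :
  (forall e, x e <= y e) -> (objective r x <= objective r y)%E.
Proof.
move=> xy; rewrite /objective; apply: le_bigmin2 => t _.
by rewrite lee_fin; apply: ler_sum.
Qed.

(** Changing the value at [e] would by itself contribute [c e] to the maximum, which would then
    exceed [M]. *)
Lemma feasible_costly (R : realType) (V : finType) (E : {set {set V}})
    (w u c x : edge E -> R) (M : R) (e : edge E) :
  feasible w u c M x -> M < c e -> x e = w e.
Proof.
move=> [xM _] Mc; apply/eqP; apply: contraTT Mc => neq_xw; rewrite -leNgt.
apply: le_trans xM; apply: le_trans (le_bigmax _ _ e).
by rewrite /hamming neq_xw mulr1.
Qed.

Theorem theorem5 (R : realType) (V : finType) (E : {set {set V}}) (v1 : V)
    (w u c : edge E -> R) (M : R)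
    (treeT : is_tree E)
    (w_le_u : forall e, w e <= u e)
    (c_gt0 : forall e, 0 < c e)
    (M_ge0 : 0 <= M) :
  optimal_solution v1 w u c M (fun e => if c e <= M then u e else w e).
Proof.
split=> [|y fy]; first split=> [|e].
(* [M_ge0] bounds the start value 0 of the maximum, and further on the zero terms of edges left
   unchanged. *)
- apply: bigmax_le => // e _; rewrite /hamming.
  case: (leP (c e) M) => [cM|_]; last by rewrite eqxx mulr0.
  by case: eqP => _; rewrite ?mulr0 ?mulr1.
- by case: ifP => _; rewrite w_le_u lexx.
apply: objective_le => e; case: (leP (c e) M) => [_|Mc].
  by have [_ /(_ e)/andP[]] := fy.
by rewrite (feasible_costly fy Mc).
Qed.
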